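(* There exists an online algorithm $\mathrm{ALG}$ for OSCC (specified for every $n$) such that $\limsup_{n\to\infty}R_n^C(\mathrm{ALG})\le 4.179$, where $R_n^C(\mathrm{ALG})=\sup_{F\in\mathcal F}\mathtt{ALG}_n(F)/\mathtt{OPT}_n(F)$.
   Context: Let $\mathcal F$ be the family of CDFs of nonnegative random variables with finite mean. In the concurrent-contracts model (OSCC), an instance is $F\in\mathcal F$ and an integer $n\ge1$; $X_1,\dots,X_n$ are i.i.d. with CDF $F$, revealed one at a time. At time $i$, knowing $F,n$, $X_1,\dots,X_i$ and past decisions, an online algorithm chooses an integer $T_i\ge0$; this contract covers times $i,\dots,i+T_i-1$ (contracts may overlap) at cost $T_iX_i$, and if time $i$ is covered by no earlier contract it must choose $T_i\ge1$. $\mathtt{ALG}_n(F)=\mathbb E[\sum_{i=1}^nT_iX_i]$, $\mathtt{OPT}_n(F)=\mathbb E[\sum_{i=1}^n\min\{X_1,\dots,X_i\}]$. *)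

(* Defs.v *)
From HB Require Import structures.
From mathcomp Require Import all_boot all_order all_algebra.
From mathcomp Require Import all_classical all_reals all_analysis.
Set Implicit Arguments. Unset Strict Implicit. Unset Printing Implicit Defensive.
Import Order.TTheory GRing.Theory Num.Theory.
Local Open Scope ring_scope.
Local Open Scope classical_set_scope.
Local Open Scope ereal_scope.

Section OSCC.
Variable R : realType.

Definition in_family (mu : probability R R) : Prop :=
  mu `[0%R, +oo[%classic = 1 /\ \int[mu]_x (`|x|%:E) < +oo.

(* Expectation of g(X_1,...,X_n), with X_1,...,X_n i.i.d. of law mu,
   as an iterated (Tonelli) integral; mu is supported on [0,+oo[. *)
Fixpoint iidE (mu : probability R R) (n : nat) : (n.-tuple R -> \bar R) -> \bar R :=
  match n with
  | 0 => fun g => g [tuple]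
  | m.+1 => fun g =>
      \int[mu]_(x in `[0%R, +oo[%classic) @iidE mu m (fun t : m.-tuple R => g [tuple of x :: t])
  end.

(* An online algorithm: for each law mu (known to the algorithm) and each
   horizon n, the contract length chosen at time i (0-indexed, i.e. time i+1
   of the paper) as a function of the realized sequence x = (X_1..X_n). *)
Definition alg_type := probability R R -> forall n : nat, 'I_n -> n.-tuple R -> nat.

Definition nonanticipating (A : alg_type) : Prop :=
  forall mu n (i : 'I_n) (x y : n.-tuple R),
    (forall j : 'I_n, (j <= i)%N -> tnth x j = tnth y j) ->
    A mu n i x = A mu n i y.

Definition measurable_alg (A : alg_type) : Prop :=
  forall mu n (i : 'I_n),
    measurable_fun [set: n.-tuple R] (fun x => ((A mu n i x)%:R : R)).

(* Feasibility: the contract of time j covers times j, ..., j + T_j - 1;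
   if time i is covered by no earlier contract then T_i >= 1. *)
Definition feasible (A : alg_type) : Prop :=
  forall mu n (x : n.-tuple R) (i : 'I_n),
    (forall j : 'I_n, (j < i)%N -> ~ (i < j + A mu n j x)%N) ->
    (0 < A mu n i x)%N.

Definition online_algorithm (A : alg_type) : Prop :=
  [/\ nonanticipating A, measurable_alg A & feasible A].

Definition ALGn (A : alg_type) (mu : probability R R) (n : nat) : \bar R :=
  iidE mu (fun x : n.-tuple R =>
    \sum_(i < n) (((A mu n i x)%:R * tnth x i)%R)%:E).

Definition OPTn (mu : probability R R) (n : nat) : \bar R :=
  iidE mu (fun x : n.-tuple R =>
    \sum_(i < n) \big[mine/+oo]_(j < n | (j <= i)%N) (tnth x j)%:E).

(* R_n^C(ALG) = sup_{F in family} ALG_n(F)/OPT_n(F)  (over F with OPT_n(F) > 0,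
   where the ratio is defined; OPT_n(F) is then a finite positive real). *)
Definition ratio_n (A : alg_type) (n : nat) : \bar R :=
  ereal_sup [set ALGn A mu n * ((fine (OPTn mu n))^-1)%:E
            | mu in [set mu : probability R R | in_family mu /\ 0 < OPTn mu n]].

End OSCC.

(* Main.v *)
(** The ratio is in fact at most 4 for every horizon.  Attach to an observation
    of quantile [u] the contract length [T] that is maximal with [u <= 2/(T+1)],
    so that the offered length satisfies [P(T >= k) = 2/(k+1)], truncate it to
    the remaining horizon, and buy it whenever it exceeds the current coverage.
    Coverage is the running maximum of independent offers, so the probability
    that it is below [a] after [t] steps telescopes to
    [a(a+1)/((a+t)(a+t+1))], and a contract of offered length [k] costs about
    [k(k+1)] times the mean of [X] on the corresponding quantile block, with a
    correction from the horizon.  On the other side the optimum is at least what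
    it pays when the best of [X_1..X_i] is the only one in its block, and the
    correction makes the block-by-block comparison hold with the factor 4.
    Laws with atoms need randomised block membership; the randomised rule is
    replaced by the deterministic one that minimises its cost-to-go at each
    step, which can only be cheaper. *)
Require Import Defs.
From HB Require Import structures.
From mathcomp Require Import all_boot all_order all_algebra.
From mathcomp Require Import all_classical all_reals all_analysis.
From mathcomp Require Import measurable_realfun.
From mathcomp Require Import ring lra zify.
Set Implicit Arguments. Unset Strict Implicit. Unset Printing Implicit Defensive.
Import Order.TTheory GRing.Theory Num.Theory.
Local Open Scope ring_scope.
Local Open Scope classical_set_scope.

(** * Expected purchased length under random offers *)

Section ContractCost.
Variable R : realFieldType.

(* Offered lengths are indexed by their predecessor: [offer_tail n k] is the
   probability of an offer of length at least [k.+1], and offers longer than [n]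
   are cut down to [n]. *)
Definition offer_tail (n k : nat) : R := if (k < n)%N then 2 / k.+2%:R else 0.

Definition offer_prob n k : R := offer_tail n k - offer_tail n k.+1.

Lemma offer_tail_ge0 n k : 0 <= offer_tail n k.
Proof. by rewrite /offer_tail; case: ifP => // _; rewrite divr_ge0. Qed.

Lemma offer_tail_le1 n k : offer_tail n k <= 1.
Proof.
rewrite /offer_tail; case: ifP => // _.
by rewrite ler_pdivrMr // mul1r ler_nat.
Qed.

Lemma offer_tail_antitone n k : offer_tail n k.+1 <= offer_tail n k.
Proof.
rewrite /offer_tail; case: ltnP => h1; last by case: ifP => // _; rewrite divr_ge0.
rewrite (ltnW h1) ler_pM2l // lef_pV2 ?posrE // ler_nat; lia.
Qed.

Lemma sum_offer_prob n b :
  \sum_(j < b) offer_prob n j = offer_tail n 0 - offer_tail n b.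
Proof.
under eq_bigr do rewrite /offer_prob -opprB.
rewrite sumrN -(big_mkord xpredT (fun j => offer_tail n j.+1 - offer_tail n j)).
by rewrite telescope_sumr // opprB.
Qed.

(* The length bought when length [k] is offered with [m.+1] steps left, the
   current one included, and the next [r] of them already covered. *)
Definition bought (k m r : nat) : nat :=
  if (r < minn k m.+1)%N then minn k m.+1 else 0%N.

Lemma maxn_bought k m r : maxn r (bought k m r) = maxn r (minn k m.+1).
Proof.
rewrite /bought; case: ifP => h //; rewrite maxn0; lia.
Qed.

(* Started uncovered, the coverage left after [t] steps is less than [a] with
   this probability. *)
Definition low_coverage (a t : nat) : R :=
  (a%:R * a.+1%:R) / ((a + t)%:R * (a + t).+1%:R).

(* Expected length bought in [m] steps from coverage [r] if every step buys as
   though it were offered length [k] while the coverage evolves by random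
   offers; [a] is the truncated offer, and reaching coverage below [a] after [t]
   steps requires in addition [r < a + t]. *)
Definition expected_length (k m r : nat) : R :=
  \sum_(t < m) let a := minn k (m - t) in
    (a * (r < a + t))%:R * low_coverage a t.

Lemma low_coverage_ge0 a t : 0 <= low_coverage a t.
Proof. by rewrite divr_ge0 ?mulr_ge0. Qed.

Lemma expected_length_ge0 k m r : 0 <= expected_length k m r.
Proof. by apply: sumr_ge0 => t _; rewrite mulr_ge0 ?low_coverage_ge0. Qed.

(** As [b <= m], cutting an offer at the horizon does not affect whether the next coverage is below
    [b]: this happens exactly when [r <= b] and the offered length is at most [b], of probability
    [1 - 2/(b+2)]. *)
Lemma sum_offer_prob_lt n r m b : (0 < b <= m)%N -> (m < n)%N ->
  \sum_(j < n) offer_prob n j * ((maxn r (bought j.+1 m r)).-1 < b)%:R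
  = (r < b.+1)%:R * (b%:R / b.+2%:R).
Proof.
move=> /andP[b0 bm] mn.
have bn : (b <= n)%N by lia.
transitivity ((r < b.+1)%:R * \sum_(j < n | (j < b)%N) offer_prob n j).
  rewrite mulr_sumr [RHS]big_mkcond; apply: eq_bigr => j _.
  rewrite maxn_bought.
  have -> : ((maxn r (minn j.+1 m.+1)).-1 < b)%N = (r < b.+1)%N && (j < b)%N by lia.
  by case: (r < _)%N; case: (j < b)%N; rewrite /= ?mulr1 ?mulr0 ?mul1r ?mul0r.
congr (_ * _).
rewrite -(big_ord_widen_cond n xpredT (offer_prob n) bn) /= sum_offer_prob.
rewrite /offer_tail; have -> : (0 < n)%N by lia.
have -> : (b < n)%N by lia.
have h : b.+2%:R != 0 :> R by rewrite pnatr_eq0.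
rewrite divff ?pnatr_eq0 //.
have e : b.+2%:R = b%:R + 2 :> R by rewrite -natrD addn2.
rewrite e in h *.
by field.
Qed.

(** The telescoping step: [low_coverage a t] is the product of [(a+s)/(a+s+2)] over [s < t]. *)
Lemma low_coverageS a t : (0 < a)%N ->
  (a + t)%:R / (a + t).+2%:R * low_coverage a t = low_coverage a t.+1.
Proof.
move=> a0; rewrite /low_coverage addnS.
have h1 : (a + t)%:R != 0 :> R by rewrite pnatr_eq0; lia.
have h2 : (a + t).+1%:R != 0 :> R by rewrite pnatr_eq0.
have h3 : (a + t).+2%:R != 0 :> R by rewrite pnatr_eq0.
move: (a + t)%:R (a + t).+1%:R (a + t).+2%:R h1 h2 h3 => x y z hx hy hz.
by field; rewrite hx hy hz.
Qed.

Lemma low_coverage0 a : (0 < a)%N -> low_coverage a 0 = 1.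
Proof.
by move=> a0; rewrite /low_coverage addn0 divff // mulf_neq0 // pnatr_eq0; lia.
Qed.

(** The term [t = 0] is the present purchase. In a later term, averaging over the present offer
    contributes the factor [(a+t)/(a+t+2)], which advances [low_coverage] by one step. *)
Lemma expected_lengthS n k m r : (0 < k)%N -> (m < n)%N ->
  expected_length k m.+1 r = (bought k m r)%:R +
    \sum_(j < n) offer_prob n j * expected_length k m (maxn r (bought j.+1 m r)).-1.
Proof.
move=> k0 mn; rewrite /expected_length big_ord_recl /=; congr (_ + _).
  rewrite subn0 addn0 low_coverage0 ?mulr1; last by lia.
  by rewrite /bought; case: ifP; rewrite ?muln1 ?muln0.
under [RHS]eq_bigr do rewrite mulr_sumr.
rewrite exchange_big /=; apply: eq_bigr => t _.
rewrite /bump /= add1n subSS; set a := minn k (m - t).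
have a0 : (0 < a)%N by rewrite /a; have := ltn_ord t; lia.
under eq_bigr do rewrite natrM -[X in _ * X]mulrA mulrCA [X in _ * X]mulrA.
rewrite -mulr_sumr -mulr_suml (@sum_offer_prob_lt n r m (a + t)) //; last first.
  by rewrite /a; have := ltn_ord t; lia.
by rewrite -mulrA low_coverageS // addnS natrM mulrA.
Qed.

Lemma sum_sqr_succ k :
  \sum_(s < k) ((k - s) ^ 2 * (k - s).+1)%:R =
  k%:R * (k%:R + 1) * (k%:R + 2) * (3 * k%:R + 1) / 12 :> R.
Proof.
elim: k => [|k IH]; first by rewrite big_ord0 !mul0r.
rewrite big_ord_recl /= subn0.
under eq_bigr do rewrite /bump /= add1n subSS.
by rewrite IH natrM natrX -![k.+1]addn1 -![(k + 1).+1]addn1 !natrD; field.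
Qed.

Lemma sum_low_coverage k d : (0 < k)%N ->
  \sum_(t < d) low_coverage k t = (k.+1%:R) * (1 - k%:R / (k + d)%:R).
Proof.
move=> k0; elim: d => [|d IH].
  by rewrite big_ord0 addn0 divff ?subrr ?mulr0 // pnatr_eq0; lia.
rewrite big_ord_recr /= IH /low_coverage addnS.
have h1 : (k + d)%:R != 0 :> R by rewrite pnatr_eq0; lia.
have h2 : (k + d).+1%:R != 0 :> R by rewrite pnatr_eq0.
rewrite -[(k + d).+1]addn1 -[k.+1]addn1 in h2 *; rewrite !natrD in h1 h2 *.
by field; rewrite h1 h2.
Qed.

(** In the first [d] steps the length [k] fits and the sum telescopes. In the last [k] steps it is
    cut to the remaining horizon, so [a + t = n] and only a power sum over a fixed denominator is
    left. *)
Lemma expected_lengthE k d : (0 < k)%N -> let n := (k + d)%N in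
  expected_length k n 0 = k%:R * k.+1%:R *
    (1 - k%:R / n%:R + (k%:R + 2) * (3 * k%:R + 1) / (12 * (n%:R * n.+1%:R))).
Proof.
move=> k0 n; rewrite /expected_length /n addnC big_split_ord /= mulrDr; congr (_ + _).
  transitivity (k%:R * \sum_(t < d) low_coverage k t).
    rewrite mulr_sumr; apply: eq_bigr => t _.
    have -> : minn k (d + k - t) = k by have := ltn_ord t; lia.
    by rewrite (_ : (0 < k + t)%N = true) ?muln1 //; lia.
  by rewrite sum_low_coverage // [(d + k)%N]addnC -mulrA.
transitivity ((\sum_(s < k) ((k - s) ^ 2 * (k - s).+1)%:R) / ((d + k)%:R * (d + k).+1%:R) : R).
  rewrite mulr_suml; apply: eq_bigr => s _.
  have := ltn_ord s => sk.
  have -> : minn k (d + k - (d + s)) = (k - s)%N by lia.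
  rewrite /low_coverage.
  have -> : (k - s + (d + s) = d + k)%N by lia.
  rewrite (_ : (0 < d + k)%N = true) ?muln1; last by lia.
  by rewrite natrM natrX !mulrA -expr2.
rewrite sum_sqr_succ.
have h1 : (d + k)%:R != 0 :> R by rewrite pnatr_eq0; lia.
have h2 : (d + k).+1%:R != 0 :> R by rewrite pnatr_eq0.
rewrite -[(d + k).+1]addn1 -[k.+1]addn1 in h2 *; rewrite !natrD in h1 h2 *.
by field; rewrite h1 h2.
Qed.

Lemma sum_succ_expr (s : R) n :
  (1 - s) ^+ 2 * \sum_(i < n) i.+1%:R * s ^+ i = 1 - s ^+ n * (1 + n%:R * (1 - s)).
Proof.
elim: n => [|n IH]; first by rewrite big_ord0 expr0 mul0r addr0 mulr0 mulr1 subrr.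
by rewrite big_ord_recr /= mulrDr IH [s ^+ n.+1]exprS -[n.+1]addn1 natrD; ring.
Qed.

(* The second-order Bernoulli bound for [(1 + 2/j)^n]. *)
Lemma expr_ratio_le (j n : nat) :
  (j%:R / (j%:R + 2)) ^+ n *
  (j%:R ^+ 2 + 2 * n%:R * j%:R + 2 * n%:R * (n%:R - 1)) <= j%:R ^+ 2 :> R.
Proof.
have j0 : 0 <= j%:R :> R by [].
elim: n => [|n]; first by rewrite expr0 mul1r !mulr0 !mul0r !addr0.
apply: le_trans; rewrite exprSr -mulrA ler_wpM2l //.
rewrite mulrAC ler_pdivrMr; last by lra.
rewrite -[n.+1]addn1 natrD.
have n0 : 0 <= n%:R :> R by [].
have : 0 <= n%:R * (n%:R - 1) :> R.
  by case: (n) => [|p]; rewrite ?mul0r // mulr_ge0 // subr_ge0 ler1n.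
move: (n%:R) (j%:R) => x y; lra.
Qed.

(** The polynomial core of [expected_length_le], in the slacks [e = k - 2] and [d = n - k]. *)
Lemma expected_length_poly_le (e d : R) : 0 <= e -> 0 <= d ->
  let j := 1 + e in let n := j + 1 + d in
  j ^+ 2 * (j + 2 + 2 * n) * (12 * (n * (n + 1))) <=
  (j ^+ 2 + 2 * n * j + 2 * n * (n - 1)) *
  (12 * (n * (n + 1)) + 12 * n * (j + 1) ^+ 2 - (j + 1) * j * (3 * j + 1)).
Proof.
move=> e0 d0 /=; set j := 1 + e; set n := j + 1 + d; rewrite -subr_ge0.
(* All coefficients of the difference are positive. *)
rewrite [X in 0 <= X](_ : _ = 936%:R * (e ^+ 0 * d ^+ 0) +
  1688%:R * (e ^+ 0 * d ^+ 1) + 1088%:R * (e ^+ 0 * d ^+ 2) +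
  288%:R * (e ^+ 0 * d ^+ 3) + 24%:R * (e ^+ 0 * d ^+ 4) +
  2270%:R * (e ^+ 1 * d ^+ 0) + 3012%:R * (e ^+ 1 * d ^+ 1) +
  1272%:R * (e ^+ 1 * d ^+ 2) + 168%:R * (e ^+ 1 * d ^+ 3) +
  2003%:R * (e ^+ 2 * d ^+ 0) + 1744%:R * (e ^+ 2 * d ^+ 1) +
  358%:R * (e ^+ 2 * d ^+ 2) + 805%:R * (e ^+ 3 * d ^+ 0) +
  366%:R * (e ^+ 3 * d ^+ 1) + 6%:R * (e ^+ 3 * d ^+ 2) +
  145%:R * (e ^+ 4 * d ^+ 0) + 18%:R * (e ^+ 4 * d ^+ 1) +
  9%:R * (e ^+ 5 * d ^+ 0));
  last by rewrite /n /j; ring.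
by rewrite !addr_ge0 ?mulr_ge0 ?exprn_ge0 ?ler0n.
Qed.

(** For a single offered length, this compares the coefficient of its block mean in the cost with
    the one in the lower bound on the optimum. Both have closed forms, and the power in the second
    is removed by the Bernoulli bound. *)
Lemma expected_length_le k n : (0 < k <= n)%N ->
  expected_length k n 0 <= 4 * \sum_(i < n) i.+1%:R * (1 - 2 / k.+1%:R) ^+ i.
Proof.
move=> /andP[k0 kn]; rewrite -(subnKC kn); set d := (n - k)%N.
rewrite expected_lengthE //; case: k k0 {kn} @d => // j _ /=; set d := (n - _)%N.
set N := (j.+1 + d)%N; set S := \sum_(i < _) _.
have jE1 : j.+1%:R = j%:R + 1 :> R by rewrite natr1.
have jE2 : j.+2%:R = j%:R + 2 :> R by rewrite -natrD addn2.
have NE : N%:R = j%:R + 1 + d%:R :> R by rewrite /N natrD jE1.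
have NE1 : N.+1%:R = N%:R + 1 :> R by rewrite natr1.
pose s : R := j%:R / (j%:R + 2).
have j0 : 0 <= j%:R :> R by [].
have d0 : 0 <= d%:R :> R by [].
have j20 : j%:R + 2 != 0 :> R by rewrite gt_eqF //; lra.
have sE : 1 - 2 / j.+2%:R = s by rewrite /s jE2; field.
have SE : 4 * S = (j%:R + 2) * (j%:R + 2 - s ^+ N * (j%:R + 2 + 2 * N%:R)).
  have := sum_succ_expr s N; rewrite -{2}sE -/S.
  have -> : 1 - s = 2 / (j%:R + 2) by rewrite -sE jE2 opprB addrC subrK.
  move=> e; have -> : 4 * S = (j%:R + 2) ^+ 2 * ((2 / (j%:R + 2)) ^+ 2 * S) by field.
  by rewrite e; field.
rewrite SE jE1 jE2 NE1 [(j%:R + 1) * (j%:R + 2)]mulrC -[leLHS]mulrA ler_pM2l; last by lra.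
have := expr_ratio_le j N; rewrite -/s; set p := s ^+ N => pB.
have N1 : 1 <= N%:R :> R by rewrite NE; lra.
have N0 : N%:R != 0 :> R by rewrite gt_eqF //; lra.
have N10 : N%:R + 1 != 0 :> R by rewrite gt_eqF //; lra.
(* The common factor [j + 2] is gone. The rest is solved for the term in [p], over the denominator
   [X]. *)
rewrite lerBrDl -lerBrDr.
set X : R := 12 * (N%:R * (N%:R + 1)).
pose Q : R := X + 12 * N%:R * (j%:R + 1) ^+ 2 - (j%:R + 1) * j%:R * (3 * j%:R + 1).
have X0 : 0 < X by rewrite !mulr_gt0 //; lra.
rewrite [leRHS](_ : _ = Q / X); last first.
  by rewrite /Q /X; field; rewrite N0 N10.
rewrite ler_pdivlMr //.
(* For [j = 0] the base [s] vanishes; the polynomial inequality, in [e = j - 1], needs [j >= 1]. *)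
have [j_eq0|jpos] := posnP j.
  have -> : p = 0 by rewrite /p /s j_eq0 mul0r expr0n.
  rewrite !mul0r /Q j_eq0 mulr0 mul0r subr0 addr_ge0 ?ltW //.
  by rewrite !mulr_gt0 // ?exprn_gt0 //; lra.
have j1 : 1 <= j%:R :> R by rewrite ler1n.
have := @expected_length_poly_le (j%:R - 1) d%:R.
rewrite subr_ge0 => /(_ j1 d0) /=.
have -> : 1 + (j%:R - 1) = j%:R :> R by ring.
rewrite -NE -/X -/Q.
set B := _ + 2 * N%:R * (N%:R - 1) => h.
have B0 : 0 < B.
  by rewrite /B ltr_wpDr ?ltr_wpDr ?exprn_gt0 ?mulr_ge0 //; lra.
(* After multiplication by [B], the Bernoulli bound replaces [p * B] by [j ^ 2]. *)
rewrite -(ler_pM2l B0); apply: le_trans h.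
rewrite [leLHS](_ : _ = p * B * (j%:R + 2 + 2 * N%:R) * X); last by ring.
rewrite ler_wpM2r ?(ltW X0) // ler_wpM2r //; lra.
Qed.

End ContractCost.

(** * The deterministic greedy rule and its admissibility *)

Section Greedy.
Variable R : realType.
Implicit Types (F : nat -> R) (W : nat -> nat -> R) (s : seq R).

Fixpoint argmin_upto F N : nat :=
  if N is M.+1 then
    if F N < F (argmin_upto F M) then N else argmin_upto F M
  else 0%N.

Lemma argmin_uptoP F N j : (j <= N)%N -> F (argmin_upto F N) <= F j.
Proof.
elim: N => [|N IH] /=; first by rewrite leqn0 => /eqP ->.
rewrite leq_eqVlt ltnS => /orP[/eqP ->|/IH h]; case: ltP => // lt.
exact: le_trans (ltW lt) h.
Qed.

(** Coverage counts the current step too; the predecessor removes it. *)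
Definition next_coverage (r T : nat) : nat := (maxn r T).-1.

Definition contract_cost W m r x T : R := T%:R * x + W m (next_coverage r T).

(* The index is shifted by one when nothing is covered, so that a purchase is
   forced. *)
Definition greedy W m r x : nat :=
  (argmin_upto (fun j => contract_cost W m r x (j + (r == 0))%N) m.+1 + (r == 0))%N.

Lemma greedy_gt0 W m x : (0 < greedy W m 0 x)%N.
Proof. by rewrite /greedy addn1. Qed.

Lemma greedy_le W m r x T : (T <= m.+1)%N -> (0 < maxn r T)%N ->
  contract_cost W m r x (greedy W m r x) <= contract_cost W m r x T.
Proof.
move=> Tm rT; rewrite /greedy.
have -> : T = (T - (r == 0) + (r == 0))%N by move: rT; case: r => [|r] /=; lia.
apply: (@argmin_uptoP (fun j => contract_cost W m r x (j + (r == 0))%N)).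
lia.
Qed.

Fixpoint coverage W n r s i : nat :=
  if i is j.+1 then
    next_coverage (coverage W n r s j)
      (greedy W (n - i) (coverage W n r s j) (nth 0 s j))
  else r.

Definition contract W n r s i : nat :=
  greedy W (n - i.+1) (coverage W n r s i) (nth 0 s i).

Definition greedy_cost W n r s : R :=
  \sum_(i < n) (contract W n r s i)%:R * nth 0 s i.

Lemma coverage_cons W n r x s i :
  coverage W n.+1 r (x :: s) i.+1 =
  coverage W n (next_coverage r (greedy W n r x)) s i.
Proof.
elim: i => [|i IH]; first by rewrite /= subSS subn0.
by rewrite [in LHS]/= -/(coverage _ _ _ _ i.+1) IH /= subSS.
Qed.

(** [coverage] recurses on the last step, whereas [iidE] has the first observation outermost; this
    form allows induction along [iidE]. *)
Lemma greedy_cost_cons W n r x s :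
  greedy_cost W n.+1 r (x :: s) =
  (greedy W n r x)%:R * x + greedy_cost W n (next_coverage r (greedy W n r x)) s.
Proof.
rewrite /greedy_cost big_ord_recl /=; congr (_ + _).
  by rewrite /contract /= subSS subn0.
apply: eq_bigr => i _; rewrite /contract /bump add1n coverage_cons /= subSS //.
Qed.

Lemma greedy_cost_ge0 W n r s : all (>= 0) s -> 0 <= greedy_cost W n r s.
Proof.
move=> s0; apply: sumr_ge0 => i _; apply: mulr_ge0 => //.
have [si|si] := ltnP i (size s); last by rewrite nth_default.
by move/allP: s0; apply; exact: mem_nth.
Qed.

Lemma eq_coverage W n (r : nat) s s' i : (forall j, (j < i)%N -> nth 0 s j = nth 0 s' j) ->
  coverage W n r s i = coverage W n r s' i.
Proof.
elim: i => [//|i IH] ss' /=; rewrite IH ?ss' // => j ji.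
by rewrite ss' // ltnW.
Qed.

(** Positive coverage is the remainder of some earlier contract: the latest one if it attained the
    maximum, otherwise the one found by induction. Feasibility follows by contraposition. *)
Lemma coverage_earlier W n s i : (0 < coverage W n 0 s i)%N ->
  exists2 j, (j < i)%N & (i + coverage W n 0 s i <= j + contract W n 0 s j)%N.
Proof.
elim: i => [//|i IH]; rewrite [coverage _ _ _ _ i.+1]/= -/(contract W n 0 s i).
rewrite /next_coverage => h.
have [le|lt] := leqP (coverage W n 0 s i) (contract W n 0 s i).
  by exists i => //; lia.
have [|j ji ij] := IH; first by lia.
by exists j; lia.
Qed.

(** Split along the countably many values of [f]. *)
Lemma measurable_nat_dep d (T : measurableType d) d' (U : measurableType d')
    (f : T -> nat) (g : nat -> T -> U) :
  measurable_fun setT f -> (forall k, measurable_fun setT (g k)) ->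
  measurable_fun setT (fun x => g (f x) x).
Proof.
move=> mf mg _ Y mY; rewrite setTI.
rewrite (_ : _ @^-1` Y = \bigcup_k ((f @^-1` [set k]) `&` (g k @^-1` Y))).
  apply: bigcupT_measurable => k; apply: measurableI.
    by rewrite -[X in measurable X]setTI; exact: mf.
  by rewrite -[X in measurable X]setTI; exact: mg.
apply/seteqP; split => [x /= gY|x [k _] [/= <-]] //.
by exists (f x).
Qed.

Lemma measurable_argmin_upto d (T : measurableType d) (F : nat -> T -> R) N :
  (forall k, measurable_fun setT (F k)) ->
  measurable_fun setT (fun x => argmin_upto (F^~ x) N).
Proof.
move=> mF; elim: N => [|N IH]; first exact: measurable_cst.
apply: measurable_fun_ifT => //.
by apply: measurable_fun_ltr => //; exact: (measurable_nat_dep IH mF).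
Qed.

Lemma measurable_nat_fun d (T : measurableType d) (g : nat -> nat) (f : T -> nat) :
  measurable_fun setT f -> measurable_fun setT (fun x => g (f x)).
Proof.
move=> mf; apply: (measurable_nat_dep mf (g := fun k _ => g k)) => k.
exact: measurable_cst.
Qed.

Lemma measurable_greedy d (T : measurableType d) W m (r : T -> nat) (x : T -> R) :
  measurable_fun setT r -> measurable_fun setT x ->
  measurable_fun setT (fun t => greedy W m (r t) (x t)).
Proof.
move=> mr mx; apply: (measurable_nat_dep mr (g := fun k t => greedy W m k (x t))) => k.
apply: (measurable_nat_fun (fun j => (j + (k == 0))%N)).
apply: (@measurable_argmin_upto _ _ (fun j t => contract_cost W m k (x t) (j + (k == 0))%N)) => j.
by apply: measurable_funD => //; exact: measurable_funM.
Qed.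

Lemma measurable_nth_tuple n i :
  measurable_fun setT (fun s : n.-tuple R => nth 0 s i).
Proof.
have [ni|ni] := ltnP i n.
  rewrite (_ : (fun _ => _) = (fun s : n.-tuple R => tnth s (Ordinal ni))).
    exact: measurable_tnth.
  by apply/funext => s; rewrite (tnth_nth 0).
rewrite (_ : (fun _ => _) = cst 0); first exact: measurable_cst.
by apply/funext => s; rewrite nth_default // size_tuple.
Qed.

Lemma measurable_coverage W n r k i :
  measurable_fun setT (fun s : k.-tuple R => coverage W n r s i).
Proof.
elim: i => [|i IH] /=; first exact: measurable_cst.
have mg : measurable_fun setT (fun s : k.-tuple R =>
    greedy W (n - i.+1) (coverage W n r s i) (nth 0 s i)).
  by apply: measurable_greedy => //; exact: measurable_nth_tuple.
apply: (measurable_nat_dep IH (g := fun c (s : k.-tuple R) => next_coverage c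
  (greedy W (n - i.+1) (coverage W n r s i) (nth 0 s i)))) => c.
exact: (measurable_nat_fun (next_coverage c)).
Qed.

Definition greedy_alg (V : probability R R -> nat -> nat -> nat -> R) : alg_type R :=
  fun mu n i x => contract (V mu n) n 0 x i.

Lemma greedy_alg_online V : online_algorithm (greedy_alg V).
Proof.
split=> [mu n i x y xy|mu n i|mu n x i unc].
- rewrite /greedy_alg /contract.
  have e j : (j <= i)%N -> nth 0 x j = nth 0 y j.
    move=> ji; have jn := leq_ltn_trans ji (ltn_ord i).
    by have := xy (Ordinal jn) ji; rewrite !(tnth_nth 0).
  by rewrite (e i) // (@eq_coverage _ _ _ x y) // => j /ltnW /e.
- apply: (measurableT_comp (f := fun k : nat => k%:R : R)) => //.
  apply: measurable_greedy; first exact: measurable_coverage.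
  exact: measurable_nth_tuple.
- rewrite /greedy_alg /contract.
  have [->|cov] := posnP (coverage (V mu n) n 0 x i); first exact: greedy_gt0.
  have [j ji h] := coverage_earlier cov.
  have jn := ltn_trans ji (ltn_ord i).
  have [] := unc (Ordinal jn) ji.
  by apply: leq_trans h; rewrite -[X in (X < _)%N]addn0 ltn_add2l.
Qed.

End Greedy.

(** * Monotonicity and product formula for the iterated expectation *)

Section NonnegIntegral.
Import HBNNSimple.

(* Measurability is not required: the integral of a nonnegative function is a
   supremum over the simple functions below it. *)
Lemma ge0_le_integral_nomeas d (T : measurableType d) (R : realType)
    (mu : {measure set T -> \bar R}) (D : set T) (f g : T -> \bar R) :
  (forall x, D x -> 0 <= f x)%E -> (forall x, D x -> f x <= g x)%E ->
  (\int[mu]_(x in D) f x <= \int[mu]_(x in D) g x)%E.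
Proof.
move=> f0 fg.
have g0 x : D x -> (0 <= g x)%E by move=> Dx; exact: le_trans (f0 x Dx) (fg x Dx).
rewrite !ge0_integralE //; apply: ereal_sup_le => _ [h hf <-]; exists h => // x.
by apply: le_trans (hf x) _; apply: lee_restrict.
Qed.

End NonnegIntegral.

Section IidE.
Variables (R : realType) (mu : probability R R).
Local Notation D := (`[0%R, +oo[%classic : set R).

Lemma in_nneg x : D x -> 0 <= x.
Proof. by rewrite /= in_itv /= andbT. Qed.

(** Nonnegativity is carried through the induction because each inner integral must be nonnegative
    for the outer comparison. *)
Lemma iidE_le n (f g : n.-tuple R -> \bar R) :
  (forall t : n.-tuple R, all (>= 0) t -> (0 <= f t <= g t)%E) ->
  (0 <= iidE mu f <= iidE mu g)%E.
Proof.
elim: n f g => [|n IH] f g fg /=; first exact: fg.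
have fgx x : D x -> (0 <= iidE mu (fun t : n.-tuple R => f [tuple of x :: t]) <=
    iidE mu (fun t : n.-tuple R => g [tuple of x :: t]))%E.
  by move=> /in_nneg x0; apply: IH => t t0; apply: fg; rewrite /= x0.
rewrite integral_ge0 /=; last by move=> x /fgx /andP[].
by apply: ge0_le_integral_nomeas => x /fgx /andP[].
Qed.

Lemma iidE_ge0 n (f : n.-tuple R -> \bar R) :
  (forall t : n.-tuple R, all (>= 0) t -> (0 <= f t)%E) -> (0 <= iidE mu f)%E.
Proof.
move=> f0; have ff (t : n.-tuple R) : all (>= 0) t -> (0 <= f t <= f t)%E.
  by move=> /f0 ->; rewrite lexx.
by case/andP: (iidE_le ff).
Qed.

(** Independence for sums of product functions. The whole sum is kept inside the induction, so
    additivity is applied only to measurable functions of one variable. *)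
Lemma iidE_sum_prod n (I : Type) (s : seq I) (C : I -> R)
    (f : I -> nat -> R -> R) (J : I -> nat -> R) :
  (forall a, 0 <= C a) -> (forall a i, measurable_fun setT (f a i)) ->
  (forall a i x, 0 <= x -> 0 <= f a i x) ->
  (forall a i, \int[mu]_(x in D) (f a i x)%:E = (J a i)%:E)%E ->
  iidE mu (fun t : n.-tuple R =>
    (\sum_(a <- s) C a * \prod_(i < n) f a i (nth 0 t i))%:E) =
  (\sum_(a <- s) C a * \prod_(i < n) J a i)%:E.
Proof.
move=> C0 mf f0 fJ.
have J0 a i : 0 <= J a i.
  by rewrite -lee_fin -fJ; apply: integral_ge0 => x /in_nneg x0; rewrite lee_fin f0.
elim: n C C0 f J mf f0 fJ J0 => [|n IH] C C0 f J mf f0 fJ J0 /=.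
  by under eq_bigr do rewrite big_ord0; under [in RHS]eq_bigr do rewrite big_ord0.
pose K a := \prod_(i < n) J a i.+1.
have K0 a : 0 <= K a by apply: prodr_ge0.
transitivity (\int[mu]_(x in D) \sum_(a <- s) ((C a * K a)%:E * (f a 0%N x)%:E))%E.
  apply: eq_integral => x; rewrite inE => /in_nneg x0.
  under eq_fun do under eq_bigr do rewrite big_ord_recl /= mulrA.
  have Cx0 a : 0 <= C a * f a 0%N x by rewrite mulr_ge0 // f0.
  rewrite (IH _ Cx0 _ _ (fun a i => mf a i.+1) (fun a i => f0 a i.+1)
    (fun a i => fJ a i.+1) (fun a i => J0 a i.+1)).
  by rewrite -sumEFin; apply: eq_bigr => a _; rewrite -EFinM mulrAC.
rewrite ge0_integral_sum //; last 2 first.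
- move=> a; apply: measurable_funTS; apply/measurable_EFinP.
  exact: measurable_funM.
- by move=> a x /in_nneg x0; rewrite -EFinM lee_fin !mulr_ge0 // f0.
rewrite -sumEFin; apply: eq_bigr => a _.
rewrite ge0_integralZl_EFin //; last 3 first.
- by move=> x /in_nneg x0; rewrite lee_fin f0.
- by apply: measurable_funTS; apply/measurable_EFinP.
- by rewrite mulr_ge0.
by rewrite fJ -EFinM big_ord_recl /= -mulrA [K a * _]mulrC.
Qed.

End IidE.

(** * Randomised offers: upper bound on the cost, lower bound on the optimum *)

Section TailWeights.
Variable R : realType.
Implicit Types (mu : probability R R) (p : nat -> R -> R).
Local Notation D := (`[0%R, +oo[%classic : set R).

(** Expand the product on the right and keep the terms with at most one factor [b]. *)
Lemma prod_addl_ge (T : eqType) (s : seq T) (a b : T -> R) : uniq s ->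
  (forall i, 0 <= a i) -> (forall i, 0 <= b i) ->
  \prod_(i <- s) a i + \sum_(j <- s) b j * \prod_(i <- s | i != j) a i <=
  \prod_(i <- s) (a i + b i).
Proof.
move=> us a0 b0; elim: s us => [_|x s IH /= /andP[xs us]].
  by rewrite !big_nil addr0.
have {}IH := IH us.
rewrite !big_cons eqxx /=.
have e1 : \prod_(i <- s | i != x) a i = \prod_(i <- s) a i.
  rewrite big_seq_cond [RHS]big_seq; apply: eq_bigl => i.
  by case: (boolP (i \in s)) => //= h; apply: contraNneq xs => <-.
have e2 : \sum_(j <- s) b j * \prod_(i <- x :: s | i != j) a i =
    a x * \sum_(j <- s) b j * \prod_(i <- s | i != j) a i.
  rewrite mulr_sumr big_seq [RHS]big_seq; apply: eq_bigr => j js.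
  rewrite big_cons; have -> : x != j by apply: contraNneq xs => ->.
  by rewrite mulrCA.
rewrite e1 e2 mulrDl.
rewrite [leLHS](_ : _ = a x * (\prod_(i <- s) a i +
  \sum_(j <- s) b j * \prod_(i <- s | i != j) a i) + b x * \prod_(i <- s) a i);
  last by ring.
apply: lerD; first exact: ler_wpM2l.
apply: ler_wpM2l => //; apply: le_trans IH.
by rewrite lerDl sumr_ge0 // => j _; rewrite mulr_ge0 // prodr_ge0.
Qed.

(* [p k x] is the conditional probability, given the observation [x], of an
   offer of length at least [k.+1]; [tw_order] says that smaller observations
   receive longer offers. *)
Record tail_weights mu n p : Prop := TailWeights {
  tw_meas : forall k, measurable_fun setT (p k);
  tw_ge0 : forall k x, 0 <= p k x;
  tw_antitone : forall k x, p k.+1 x <= p k x;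
  tw_first : forall x, p 0%N x = 1;
  tw_last : forall x, p n x = 0;
  tw_integral : forall k, (\int[mu]_(x in D) (p k x)%:E = (offer_tail R n k)%:E)%E;
  tw_order : forall k x y, 0 < p k x -> p k y < 1 -> x <= y }.

(** The conditional probability of an offer of length exactly [k.+1]; [offer_mean] is then the mean
    of the observation restricted to that event. *)
Definition offer_weight p k x : R := p k x - p k.+1 x.

Definition offer_mean mu p k : R :=
  fine (\int[mu]_(x in D) (x * offer_weight p k x)%:E).

Section Fixed.
Variables (mu : probability R R) (n : nat) (p : nat -> R -> R).
Hypotheses (Hmu : in_family mu) (Hp : tail_weights mu n p).

Local Notation w := (offer_weight p).
Local Notation c := (offer_mean mu p).

Lemma tw_le1 k x : p k x <= 1.
Proof.
elim: k => [|k IH]; first by rewrite (tw_first Hp).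
exact: le_trans (tw_antitone Hp k x) IH.
Qed.

Lemma offer_weight_ge0 k x : 0 <= w k x.
Proof. by rewrite subr_ge0 (tw_antitone Hp). Qed.

Lemma offer_weight_le1 k x : w k x <= 1.
Proof. by rewrite lerBlDr ler_wpDr ?(tw_ge0 Hp) // tw_le1. Qed.

Lemma measurable_offer_weight k : measurable_fun setT (w k).
Proof. by apply: measurable_funB; exact: (tw_meas Hp). Qed.

Lemma sum_offer_weight x : \sum_(k < n) w k x = 1.
Proof.
under eq_bigr do rewrite /offer_weight -opprB.
rewrite sumrN -(big_mkord xpredT (fun k => p k.+1 x - p k x)) telescope_sumr //.
by rewrite (tw_first Hp) (tw_last Hp) sub0r opprK.
Qed.

Lemma integral_offer_weight k :
  (\int[mu]_(x in D) (w k x)%:E = (offer_prob R n k)%:E)%E.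
Proof.
have : (\int[mu]_(x in D) ((w k x)%:E + (p k.+1 x)%:E) = (offer_tail R n k)%:E)%E.
  by rewrite -(tw_integral Hp); apply: eq_integral => x _; rewrite -EFinD subrK.
rewrite ge0_integralD //; last 4 first.
- by move=> x _; rewrite lee_fin offer_weight_ge0.
- by apply: measurable_funTS; apply/measurable_EFinP; exact: measurable_offer_weight.
- by move=> x _; rewrite lee_fin (tw_ge0 Hp).
- by apply: measurable_funTS; apply/measurable_EFinP; exact: (tw_meas Hp).
rewrite (tw_integral Hp) /offer_prob EFinB => <-.
by rewrite addeK.
Qed.

Lemma integral_mul_offer_weight k :
  (\int[mu]_(x in D) (x * w k x)%:E = (c k)%:E)%E.
Proof.
rewrite /offer_mean fineK // ge0_fin_numE; last first.
  by apply: integral_ge0 => x /in_nneg x0; rewrite lee_fin mulr_ge0 // offer_weight_ge0.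
apply: le_lt_trans (Hmu.2).
have sub : (\int[mu]_(x in D) `|x|%:E <= \int[mu]_x `|x|%:E)%E.
  apply: ge0_subset_integral => //; apply/measurable_EFinP.
  exact: normr_measurable.
apply: le_trans sub.
apply: ge0_le_integral_nomeas => x /in_nneg x0; rewrite lee_fin.
  by rewrite mulr_ge0 // offer_weight_ge0.
by rewrite ger0_norm // ler_piMr // offer_weight_le1.
Qed.

Lemma offer_mean_ge0 k : 0 <= c k.
Proof.
rewrite -lee_fin -integral_mul_offer_weight; apply: integral_ge0 => x /in_nneg x0.
by rewrite lee_fin mulr_ge0 // offer_weight_ge0.
Qed.

Lemma integral_offer_affine k (a b : R) : 0 <= a -> 0 <= b ->
  (\int[mu]_(x in D) (w k x * (a + b * x))%:E = (a * offer_prob R n k + b * c k)%:E)%E.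
Proof.
move=> a0 b0.
have mw := measurable_offer_weight k.
rewrite EFinD !EFinM -integral_offer_weight -integral_mul_offer_weight.
rewrite -!ge0_integralZl_EFin //; first last.
- by apply: measurable_funTS; apply/measurable_EFinP.
- by move=> x _; rewrite lee_fin offer_weight_ge0.
- by apply: measurable_funTS; apply/measurable_EFinP; exact: measurable_funM.
- by move=> x /in_nneg x0; rewrite lee_fin mulr_ge0 // offer_weight_ge0.
rewrite -ge0_integralD //; first last.
- apply: measurable_funTS; apply/measurable_EFinP.
  by apply: measurable_funM => //; exact: measurable_funM.
- by move=> x /in_nneg x0; rewrite lee_fin !mulr_ge0 // offer_weight_ge0.
- by apply: measurable_funTS; apply/measurable_EFinP; exact: measurable_funM.
- by move=> x _; rewrite lee_fin mulr_ge0 // offer_weight_ge0.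
by apply: eq_integral => x _; rewrite -!EFinM -EFinD; congr (_%:E); ring.
Qed.

(** The expected cost of the randomised rule. Coverage is independent of the current observation and
    offer, so the length factors out of the mean price. *)
Definition cost_to_go (m r : nat) : R := \sum_(k < n) c k * expected_length R k.+1 m r.

Lemma cost_to_go_ge0 m r : 0 <= cost_to_go m r.
Proof. by apply: sumr_ge0 => k _; rewrite mulr_ge0 ?offer_mean_ge0 ?expected_length_ge0. Qed.

(** The dynamic programming equation of the randomised rule. *)
Lemma cost_to_goS m r : (m < n)%N ->
  cost_to_go m.+1 r = \sum_(k < n)
    (cost_to_go m (next_coverage r (bought k.+1 m r)) * offer_prob R n k +
     (bought k.+1 m r)%:R * c k).
Proof.
move=> mn; rewrite [RHS]big_split /= [RHS]addrC /cost_to_go.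
under [LHS]eq_bigr do rewrite (@expected_lengthS R n _ _ _ _ mn) // mulrDr.
rewrite big_split /=; congr (_ + _).
  by apply: eq_bigr => k _; rewrite mulrC.
under [RHS]eq_bigr do rewrite mulr_suml.
rewrite exchange_big /=; apply: eq_bigr => k _.
by rewrite mulr_sumr; apply: eq_bigr => j _; rewrite mulrCA mulrC /next_coverage.
Qed.

(** The greedy choice costs no more than any feasible purchase, hence no more than the average of
    the purchases [bought] under the weights [w k x]; integrating over [x] gives [cost_to_goS]. The
    amount [a] already paid stays inside the expectation, which avoids splitting [iidE]. *)
Lemma greedy_cost_le m r a : (m <= n)%N -> 0 <= a ->
  (iidE mu (fun t : m.-tuple R => (a + greedy_cost cost_to_go m r t)%:E)
   <= (a + cost_to_go m r)%:E)%E.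
Proof.
elim: m r a => [|m IH] r a mn a0 /=.
  by rewrite lee_fin lerD2l /greedy_cost big_ord0 cost_to_go_ge0.
pose F k x : R := a + contract_cost cost_to_go m r x (bought k.+1 m r).
apply: (@le_trans _ _ (\int[mu]_(x in D) (\sum_(k < n) w k x * F k x)%:E)%E).
  apply: ge0_le_integral_nomeas => x /in_nneg x0.
    apply: iidE_ge0 => t t0.
    by rewrite lee_fin addr_ge0 // greedy_cost_ge0 //= x0.
  apply: (@le_trans _ _ (a + contract_cost cost_to_go m r x (greedy cost_to_go m r x))%:E).
    under eq_fun do rewrite greedy_cost_cons addrA.
    rewrite /contract_cost addrA; apply: IH; first exact: ltnW.
    by rewrite addr_ge0 // mulr_ge0.
  rewrite lee_fin -[leLHS]mul1r -(sum_offer_weight x) mulr_suml.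
  apply: ler_sum => k _; apply: ler_wpM2l; first exact: offer_weight_ge0.
  rewrite lerD2l; apply: greedy_le; last by rewrite maxn_bought; lia.
  by rewrite /bought; case: ifP => //; lia.
under eq_integral do rewrite -sumEFin.
rewrite ge0_integral_sum //; last 2 first.
- move=> k; apply: measurable_funTS; apply/measurable_EFinP.
  apply: measurable_funM; first exact: measurable_offer_weight.
  by apply: measurable_funD => //; apply: measurable_funD => //; exact: measurable_funM.
- move=> k x /in_nneg x0; rewrite lee_fin mulr_ge0 ?offer_weight_ge0 //.
  by rewrite !addr_ge0 ?mulr_ge0 ?cost_to_go_ge0.
under eq_bigr => k _.
  rewrite (_ : (\int[mu]_(x in D) _)%E =
      ((a + cost_to_go m (next_coverage r (bought k.+1 m r))) * offer_prob R n k
       + (bought k.+1 m r)%:R * c k)%:E); last first.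
    rewrite -integral_offer_affine ?addr_ge0 ?cost_to_go_ge0 //.
    by apply: eq_integral => x _; rewrite /F /contract_cost -addrA [X in a + X]addrC.
  over.
rewrite sumEFin lee_fin cost_to_goS //.
under eq_bigr do rewrite mulrDl -addrA.
rewrite big_split /= -mulr_sumr lerD2r ler_piMr //.
by rewrite sum_offer_prob lerBlDr ler_wpDr ?offer_tail_ge0 ?offer_tail_le1.
Qed.

(* The summands are the probabilities of the disjoint events that [j] receives
   length [k.+1] and every other index less. *)
Lemma sum_unique_max_le1 (T : eqType) (s : seq T) (y : T -> R) : uniq s ->
  \sum_(k < n) \sum_(j <- s) w k (y j) * \prod_(l <- s | l != j) (1 - p k (y l)) <= 1.
Proof.
move=> us; pose phi k := \prod_(l <- s) (1 - p k (y l)).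
have p1 k x : 0 <= 1 - p k x by rewrite subr_ge0 tw_le1.
apply: (@le_trans _ _ (\sum_(k < n) (phi k.+1 - phi k))).
  apply: ler_sum => k _; rewrite lerBrDl.
  apply: le_trans (prod_addl_ge us (fun l => p1 k (y l))
    (fun l => offer_weight_ge0 k (y l))) _.
  by rewrite /phi le_eqVlt; apply/orP; left; apply/eqP; apply: eq_bigr => l _;
    rewrite /offer_weight addrA subrK.
rewrite -(big_mkord xpredT (fun k => phi k.+1 - phi k)) telescope_sumr //.
rewrite lerBlDr -[leLHS]addr0 lerD ?prodr_ge0 //.
by rewrite /phi big1 // => l _; rewrite (tw_last Hp) subr0.
Qed.

(** A nonzero term with [j != l0] means that [j] can receive length [k.+1] while [l0] receives less,
    so [y j <= y l0] by [tw_order]. The weights sum to at most 1. *)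
Lemma sum_unique_max_le (T : eqType) (s : seq T) (y : T -> R) l0 :
  uniq s -> l0 \in s -> (forall l, l \in s -> 0 <= y l) ->
  \sum_(k < n) \sum_(j <- s) y j * (w k (y j) * \prod_(l <- s | l != j) (1 - p k (y l)))
  <= y l0.
Proof.
move=> us l0s y0.
apply: (@le_trans _ _ (y l0 * \sum_(k < n) \sum_(j <- s)
  w k (y j) * \prod_(l <- s | l != j) (1 - p k (y l)))); last first.
  by rewrite ler_piMr ?y0 // sum_unique_max_le1.
rewrite mulr_sumr; apply: ler_sum => k _; rewrite mulr_sumr big_seq [leRHS]big_seq.
apply: ler_sum => j js.
set P := \prod_(l <- s | l != j) _.
have P0 : 0 <= P by apply: prodr_ge0 => l _; rewrite subr_ge0 tw_le1.
have [->//|jl0] := eqVneq j l0.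
have [w0|w0] := ltP 0 (w k (y j)); last first.
  have -> : w k (y j) = 0 by apply/eqP; rewrite eq_le w0 offer_weight_ge0.
  by rewrite mul0r !mulr0.
have [p1|p1] := ltP (p k (y l0)) 1; last first.
  have -> : P = 0.
    apply/eqP; rewrite /P prodf_seq_eq0; apply/hasP; exists l0 => //.
    by rewrite eq_sym jl0 /= subr_eq0 eq_le p1 tw_le1.
  by rewrite !mulr0.
apply: ler_wpM2r; first by rewrite mulr_ge0 // ltW.
apply: (tw_order Hp) p1; apply: lt_le_trans w0 _.
by rewrite lerBlDr lerDl (tw_ge0 Hp).
Qed.

(** For [j <= i], the product over [l] is the price at [j] times the probability that, among the
    times up to [i], [j] is offered exactly [k.+1] and all others less. *)
Let factor (a : 'I_n * ('I_n * 'I_n)) (l : nat) : R -> R :=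
  let: (k, (i, j)) := a in
  if l == j then fun x => x * w k x
  else if (l <= i)%N then fun x => 1 - p k x else cst 1.

Let factor_mean (a : 'I_n * ('I_n * 'I_n)) (l : nat) : R :=
  let: (k, (i, j)) := a in
  if l == j then c k else if (l <= i)%N then 1 - offer_tail R n k else 1.

Let measurable_factor a l : measurable_fun setT (factor a l).
Proof.
case: a => k [i j]; rewrite /factor; case: ifP => _.
  by apply: measurable_funM => //; exact: measurable_offer_weight.
case: ifP => _; last exact: measurable_cst.
by apply: measurable_funB => //; exact: (tw_meas Hp).
Qed.

Let factor_ge0 a l x : 0 <= x -> 0 <= factor a l x.
Proof.
move=> x0; case: a => k [i j]; rewrite /factor; case: ifP => _.
  by rewrite mulr_ge0 ?offer_weight_ge0.
by case: ifP => // _; rewrite subr_ge0 tw_le1.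
Qed.

Let integral_factor a l :
  (\int[mu]_(x in D) (factor a l x)%:E = (factor_mean a l)%:E)%E.
Proof.
have mu1 : (\int[mu]_(x in D) 1 = 1)%E by rewrite integral_cst // mul1e; exact: Hmu.1.
case: a => k [i j]; rewrite /factor /factor_mean; case: ifP => _.
  exact: integral_mul_offer_weight.
case: ifP => _ //.
have : (\int[mu]_(x in D) ((1 - p k x)%:E + (p k x)%:E) = 1)%E.
  by rewrite -[RHS]mu1; apply: eq_integral => x _; rewrite -EFinD subrK.
rewrite ge0_integralD //; last 4 first.
- by move=> x _; rewrite lee_fin subr_ge0 tw_le1.
- apply: measurable_funTS; apply/measurable_EFinP.
  by apply: measurable_funB => //; exact: (tw_meas Hp).
- by move=> x _; rewrite lee_fin (tw_ge0 Hp).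
- by apply: measurable_funTS; apply/measurable_EFinP; exact: (tw_meas Hp).
by rewrite (tw_integral Hp) EFinB => <-; rewrite addeK.
Qed.

Let sum_le_ord (i : 'I_n) : \sum_(j < n) ((j <= i)%N%:R : R) = i.+1%:R.
Proof.
rewrite -natr_sum; congr (_%:R).
transitivity (\sum_(j < n | (j < i.+1)%N) 1)%N; first by rewrite [RHS]big_mkcond.
by rewrite -(big_ord_widen_cond n xpredT (fun _ => 1%N)) // sum1_card card_ord.
Qed.

Let prod_factor_mean (k i j : 'I_n) : (j <= i)%N ->
  \prod_(l < n) factor_mean (k, (i, j)) l = c k * (1 - offer_tail R n k) ^+ i.
Proof.
move=> ji; rewrite (bigD1 j) //= eqxx; congr (_ * _).
transitivity (\prod_(l < n | (l != j) && (l <= i)%N) (1 - offer_tail R n k)).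
  rewrite [RHS]big_mkcondr /=; apply: eq_bigr => l lj.
  by have -> : (l == j :> nat) = false by apply: negbTE.
rewrite prodr_const; congr (_ ^+ _).
(* Adding [j] back gives all [i.+1] indices up to [i]. *)
apply: succn_inj; rewrite -[RHS](_ : #|[pred l : 'I_n | (l <= i)%N]| = _); last first.
  rewrite -sum1_card; have := sum_le_ord i; rewrite -natr_sum => /eqP.
  rewrite eqr_nat => /eqP <-; rewrite [LHS]big_mkcond; apply: eq_bigr => l _.
  by rewrite inE; case: (_ <= _)%N.
rewrite [RHS](cardD1 j) inE ji add1n; congr _.+1.
Qed.

Let sum_factor_le_min (t : n.-tuple R) (i l0 : 'I_n) : all (>= 0) t -> (l0 <= i)%N ->
  \sum_(k < n) \sum_(j < n) (j <= i)%N%:R * \prod_(l < n) factor (k, (i, j)) l (nth 0 t l)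
  <= tnth t l0.
Proof.
move=> t0 l0i; pose s := [seq l : 'I_n <- index_enum 'I_n | (l <= i)%N].
have us : uniq s by rewrite filter_uniq // index_enum_uniq.
have l0s : l0 \in s by rewrite mem_filter l0i mem_index_enum.
have y0 l : l \in s -> 0 <= tnth t l by move=> _; exact: (all_tnthP t0).
apply: le_trans (sum_unique_max_le us l0s y0); rewrite le_eqVlt; apply/orP; left.
apply/eqP; apply: eq_bigr => k _; rewrite /s big_filter [RHS]big_mkcond /=.
apply: eq_bigr => j _; case: ifP => ji; last by rewrite mul0r.
rewrite mul1r (bigD1 j) //= eqxx -tnth_nth mulrA; congr (_ * _).
rewrite big_filter_cond [RHS]big_mkcondl [RHS]big_mkcond [LHS]big_mkcond.
apply: eq_bigr => l _ /=.
have -> : (l == j :> nat) = (l == j) by [].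
by rewrite -tnth_nth; case: eqVneq; case: (_ <= _)%N.
Qed.

Let sum_triple (F : 'I_n * ('I_n * 'I_n) -> R) :
  \sum_a F a = \sum_(k < n) \sum_(i < n) \sum_(j < n) F (k, (i, j)).
Proof.
transitivity (\sum_(k < n) \sum_ij F (k, ij)).
  by rewrite (pair_bigA _ (fun k ij => F (k, ij))); apply: eq_bigr => -[].
apply: eq_bigr => k _.
by rewrite (pair_bigA _ (fun i j => F (k, (i, j)))); apply: eq_bigr => -[].
Qed.

(** The running minimum dominates the sum of these products over [k] and [j <= i]. Their
    expectations do not depend on [j], which yields the factor [i.+1]. *)
Lemma OPTn_ge :
  ((\sum_(k < n) c k * \sum_(i < n) i.+1%:R * (1 - offer_tail R n k) ^+ i)%:E
   <= OPTn mu n)%E.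
Proof.
pose C (a : 'I_n * ('I_n * 'I_n)) : R := (a.2.2 <= a.2.1)%N%:R.
have C0 a : 0 <= C a by [].
have := @iidE_sum_prod R mu n _ (index_enum _) C factor factor_mean C0
  measurable_factor factor_ge0 integral_factor.
rewrite (_ : \sum_(a <- _) _ * \prod_(i < n) factor_mean a i =
  \sum_(k < n) c k * \sum_(i < n) i.+1%:R * (1 - offer_tail R n k) ^+ i) => [<-|]; last first.
  rewrite sum_triple.
  apply: eq_bigr => k _; rewrite mulr_sumr.
  apply: eq_bigr => i _; rewrite mulrCA -sum_le_ord mulr_suml.
  apply: eq_bigr => j _; rewrite /C /=; case: leqP => ji; last by rewrite !mul0r.
  by rewrite prod_factor_mean.
set f := fun t : n.-tuple R => _.
suff fg (t : n.-tuple R) : all (>= 0) t -> (0 <= f t <=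
    \sum_(i < n) \big[mine/+oo]_(j < n | (j <= i)%N) (tnth t j)%:E)%E.
  by case/andP: (iidE_le mu fg).
move=> t0; rewrite /f.
rewrite lee_fin sumr_ge0 /=; last first.
  move=> a _; rewrite mulr_ge0 // prodr_ge0 // => i _; apply: factor_ge0.
  by rewrite -tnth_nth (all_tnthP t0).
rewrite sum_triple.
rewrite exchange_big /= -sumEFin; apply: lee_sum => i _.
set S := (X in (X%:E <= _)%E).
apply: (big_ind (fun z => S%:E <= z)%E) => [|x y hx hy|l0 l0i]; first exact: leey.
  by rewrite le_min hx.
by rewrite lee_fin sum_factor_le_min.
Qed.

End Fixed.
End TailWeights.

(** * Quantiles and the splitting of atoms *)

Section Quantiles.
Variables (R : realType) (mu : probability R R).
Local Notation D := (`[0%R, +oo[%classic : set R).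
Hypothesis muD : mu D = 1%E.

Let F (x : R) : R := fine (mu `]-oo, x]).
Let G (x : R) : R := fine (mu `]-oo, x[).

Let FE x : mu `]-oo, x] = (F x)%:E.
Proof. by rewrite /F fineK // fin_num_measure. Qed.

Let GE x : mu `]-oo, x[ = (G x)%:E.
Proof. by rewrite /G fineK // fin_num_measure. Qed.

Let muC : mu (~` D) = 0%E.
Proof. by rewrite probability_setC // [X in (1 - X)%E]muD subee. Qed.

Let mu_le (A B : set R) : measurable A -> measurable B -> A `<=` B ->
  (mu A <= mu B)%E.
Proof. by move=> mA mB AB; apply: le_measure => //; rewrite inE. Qed.

Let muID (A : set R) : measurable A -> mu (A `&` D) = mu A.
Proof.
move=> mA; have mAD : measurable (A `&` D) by exact: measurableI.
have mAC : measurable (A `&` ~` D) by apply: measurableI => //; exact: measurableC.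
apply/eqP; rewrite eq_le; apply/andP; split; first by apply: mu_le => // x [].
have e : A = (A `&` D) `|` (A `&` ~` D) by rewrite -setIUr setUv setIT.
rewrite {1}e measureU //; last by rewrite setIACA setICr setI0.
have : (mu (A `&` ~` D) <= 0)%E.
  by rewrite -muC; apply: mu_le => [||x []//] //; exact: measurableC.
by move=> h; rewrite -[leRHS]adde0 leeD.
Qed.

Let F_split x : F x = G x + fine (mu [set x]).
Proof.
apply: EFin_inj; rewrite EFinD -FE -GE fineK ?fin_num_measure //.
rewrite -measureU //; last first.
  by apply/seteqP; split => [y []|//] /=; rewrite in_itv /= => /[swap] ->; rewrite ltxx.
by rewrite setUitv1.
Qed.

(** Take the infimum of the points where [F] reaches [q]: there is no mass below 0, [F] tends to 1,
    and right continuity gives [q <= F a] at the infimum. *)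
Let exists_quantile q : 0 < q -> q < 1 ->
  exists a, q <= F a /\ forall x, x < a -> F x < q.
Proof.
move=> q0 q1; pose S := [set x | q <= F x].
have F0 x : x < 0 -> F x = 0.
  move=> x0; rewrite /F (_ : mu _ = 0%E) //; apply/eqP.
  rewrite eq_le measure_ge0 andbT.
  rewrite -muC mu_le //; first exact: measurableC.
  move=> y /=; rewrite !in_itv /= andbT => yx; apply/negP.
  by rewrite -ltNge; exact: le_lt_trans yx x0.
have Fmono x y : x <= y -> F x <= F y.
  move=> xy; rewrite -lee_fin -!FE mu_le //.
  by move=> z; rewrite /= !in_itv /= => /le_trans; apply.
have lbS : lbound S 0.
  by move=> x /= Sx; rewrite leNgt; apply/negP => /F0 e; move: Sx; rewrite /S /= e leNgt q0.
have S0 : S !=set0.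
  have cv : (mu `]-oo, (k%:R : R)] @[k --> \oo] --> mu setT)%E.
    have <- : \bigcup_k `]-oo, (k%:R : R)]%classic = setT.
      rewrite -subTset => x _; exists (Num.truncn x).+1 => //.
      by rewrite /= in_itv /= ltW // truncnS_gt.
    apply: nondecreasing_cvg_mu => //; first exact: bigcup_measurable.
    move=> k l kl; apply/subsetPset => x /=; rewrite !in_itv /= => /le_trans.
    by apply; rewrite ler_nat.
  apply: contrapT => h.
  have : (mu setT <= q%:E)%E.
    rewrite -(cvg_lim _ cv) //; apply: lime_le; first by apply/cvg_ex; exists (mu setT).
    apply: nearW => k; rewrite FE lee_fin leNgt; apply/negP => /ltW qk.
    by apply: h; exists k%:R.
  by rewrite probability_setT lee_fin leNgt q1.
exists (inf S); split.
  have cv : (mu `]-oo, (inf S + k.+1%:R^-1)%R] @[k --> \oo] --> mu `]-oo, inf S])%E.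
    rewrite (@itvNycEbigcap R false (inf S)); apply: nonincreasing_cvg_mu => //.
    - by rewrite -ge0_fin_numE // fin_num_measure.
    - exact: bigcap_measurable.
    - move=> k l kl; apply/subsetPset; apply: subset_itvl.
      by rewrite bnd_simp lerD2l lef_pV2 ?posrE // ler_nat.
  rewrite -lee_fin -FE -(cvg_lim _ cv) //; apply: lime_ge.
    by apply/cvg_ex; exists (mu `]-oo, inf S]).
  apply: nearW => k; rewrite FE lee_fin.
  have [x Sx xk] : exists2 x, S x & x < inf S + k.+1%:R^-1.
    by apply: inf_adherent => //; split => //; exists 0.
  exact: le_trans Sx (Fmono _ _ (ltW xk)).
move=> x xa; rewrite ltNge; apply/negP => Sx.
by move: xa; rewrite ltNge => /negP; apply; apply: ge_inf => //; exists 0.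
Qed.

Let G_le a q : (forall x, x < a -> F x < q) -> G a <= q.
Proof.
move=> h.
have cv : (mu `]-oo, (a - k.+1%:R^-1)%R] @[k --> \oo] --> mu `]-oo, a[)%E.
  have <- : \bigcup_k `]-oo, (a - k.+1%:R^-1)%R]%classic = `]-oo, a[%classic.
    apply/seteqP; split => [x [k _] /=|x /=]; rewrite !in_itv /=.
      by move=> /le_lt_trans; apply; rewrite ltrBlDr ltrDl invr_gt0.
    move=> xa; have [k hk] := @ltr_add_invr R x a xa.
    by exists k => //=; rewrite in_itv /= lerBrDr ltW.
  apply: nondecreasing_cvg_mu => //; first exact: bigcup_measurable.
  move=> k l kl; apply/subsetPset; apply: subset_itvl.
  by rewrite bnd_simp lerD2l lerN2 lef_pV2 ?posrE // ler_nat.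
rewrite -lee_fin -GE -(cvg_lim _ cv) //; apply: lime_le.
  by apply/cvg_ex; exists (mu `]-oo, a[).
by apply: nearW => k; rewrite FE lee_fin ltW // h // ltrBlDr ltrDl invr_gt0.
Qed.

(* [P q x] is the probability that an observation [x], placed uniformly at
   random in the quantile interval of its atom, has quantile at most [q]. *)
Lemma exists_split_weight : exists P : R -> R -> R,
  [/\ [/\ forall q, measurable_fun setT (P q), forall q x, 0 <= P q x,
      forall x, P 0 x = 0 & forall x, P 1 x = 1],
      forall q r x, q <= r -> P q x <= P r x,
      forall q, 0 <= q <= 1 -> (\int[mu]_(x in D) (P q x)%:E = q%:E)%E &
      forall q x y, 0 < P q x -> P q y < 1 -> x <= y].
Proof.
have /choice[a ha] : forall q, exists a, 0 < q < 1 -> q <= F a /\ forall x, x < a -> F x < q.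
  move=> q; have [/andP[q0 q1]|] := boolP (0 < q < 1); last by exists 0.
  by have [a ?] := exists_quantile q0 q1; exists a.
have Ga q : 0 < q < 1 -> G (a q) <= q by move=> /ha[_ /G_le].
(* The share of the atom at [a q] that lies below quantile [q]; it is 0 by the division convention
   if there is no atom. *)
pose th q := (q - G (a q)) / (F (a q) - G (a q)).
have FG x : 0 <= F x - G x by rewrite F_split addrAC subrr add0r fine_ge0.
have th0 q : 0 < q < 1 -> 0 <= th q.
  by move=> q01; rewrite divr_ge0 // subr_ge0 Ga.
have th1 q : 0 < q < 1 -> th q <= 1.
  move=> q01; have [h|h] := eqVneq (F (a q) - G (a q)) 0.
    by rewrite /th h invr0 mulr0.
  rewrite ler_pdivrMr ?mul1r ?lerD2r; first by have [] := ha q q01.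
  by rewrite lt_def h FG.
pose P q x := if q <= 0 then 0 else if 1 <= q then 1 else
  if x < a q then 1 else if x == a q then th q else 0.
have P0 q x : 0 <= P q x.
  rewrite /P; case: (leP q 0) => // q0; case: (leP 1 q) => // q1; case: ifP => // _.
  by case: ifP => // _; rewrite th0 // q0.
have P1 q x : P q x <= 1.
  rewrite /P; case: (leP q 0) => // q0; case: (leP 1 q) => // q1; case: ifP => // _.
  by case: ifP => // _; rewrite th1 // q0.
exists P; split; first split => //.
- move=> q; rewrite /P; have [_|_] := leP q 0; first exact: measurable_cst.
  have [_|_] := leP 1 q; first exact: measurable_cst.
  apply: measurable_fun_ifT => //; first exact: measurable_fun_ltr.
  by apply: measurable_fun_ifT => //; exact: measurable_fun_eqr.
- by move=> x; rewrite /P lexx.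
- by move=> x; rewrite /P lexx ler10.
- move=> q r x qr; rewrite [leRHS]/P.
  have [r0|r0] := leP r 0; first by rewrite /P (le_trans qr r0).
  have [r1|r1] := leP 1 r; first exact: P1.
  rewrite /P; have [q0|q0] := leP q 0.
    by have := P0 r x; rewrite /P [r <= 0]leNgt r0 [1 <= r]leNgt r1.
  have q1 := le_lt_trans qr r1; rewrite [1 <= q]leNgt q1 /=.
  have q01 : 0 < q < 1 by rewrite q0.
  have r01 : 0 < r < 1 by rewrite (lt_le_trans q0 qr).
  have aqr : a q <= a r.
    rewrite leNgt; apply/negP => /(ha q q01).2; rewrite ltNge => /negP; apply.
    exact: le_trans qr (ha r r01).1.
  case: (ltgtP x (a r)) => xr.
  + by case: ifP => // _; case: ifP => // _; exact: th1.
  + by rewrite (gt_eqF (le_lt_trans aqr xr)) (lt_gtF (le_lt_trans aqr xr)).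
  (* At [x = a r]: [a r < a q] is impossible, [a q < a r] makes the weight for [q] vanish, and on a
     shared point [th] is nondecreasing in its argument. *)
  + rewrite xr; case: (ltgtP (a r) (a q)) => [arq|_|e].
    * by move: aqr; rewrite leNgt arq.
    * exact: th0.
    * by rewrite /th -e ler_wpM2r ?invr_ge0 ?FG // lerD2r.
- move=> q /andP[q0 q1]; rewrite /P.
  have [q0'|{}q0] := leP q 0.
    by rewrite integral0 (_ : q = 0) //; apply/eqP; rewrite eq_le q0 q0'.
  have [q1'|{}q1] := leP 1 q.
    rewrite integral_cst // mul1e [LHS]muD (_ : q = 1) //.
    by apply/eqP; rewrite eq_le q1 q1'.
  have q01 : 0 < q < 1 by rewrite q0.
  transitivity (\int[mu]_(x in D) ((\1_`]-oo, a q[ x)%:E + (th q)%:E * (\1_[set a q] x)%:E))%E.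
    apply: eq_integral => x _; rewrite !indicE -EFinM -EFinD; congr (_%:E).
    rewrite !mem_setE in_set1 in_itv /=; case: (ltgtP x (a q)) => h;
      by rewrite /= ?mulr0 ?addr0 ?mulr1 ?add0r.
  rewrite ge0_integralD //; last 3 first.
  - by apply: measurable_funTS; apply/measurable_EFinP; exact: measurable_indic.
  - by move=> x _; rewrite -EFinM lee_fin mulr_ge0 // th0.
  - apply: measurable_funTS; apply: measurable_funeM; apply/measurable_EFinP.
    exact: measurable_indic.
  rewrite ge0_integralZl_EFin //; last 2 first.
  - by apply: measurable_funTS; apply/measurable_EFinP; exact: measurable_indic.
  - exact: th0.
  have mu_indic (A : set R) : measurable A ->
      (\int[mu]_(x in D) (\1_A x)%:E = mu A)%E.
    by move=> mA; rewrite integral_indic //; exact: muID.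
  rewrite !mu_indic // GE.
  rewrite -[X in (_ * X)%E]fineK ?fin_num_measure // -EFinM -EFinD; congr (_%:E).
  have -> : fine (mu [set a q]) = F (a q) - G (a q) by rewrite F_split addrAC subrr add0r.
  (* Without an atom, [G (a q) <= q <= F (a q)] collapses to equality. *)
  have [h|h] := eqVneq (F (a q) - G (a q)) 0; last by rewrite /th divfK // addrC subrK.
  rewrite h mulr0 addr0; apply/eqP; rewrite eq_le Ga //=.
  by move/eqP: h; rewrite subr_eq0 => /eqP <-; have [] := ha q q01.
- move=> q x y; rewrite /P; case: (leP q 0) => [_|q0]; first by rewrite ltxx.
  case: (leP 1 q) => [_ _|q1]; first by rewrite ltxx.
  case: (ltgtP x (a q)) => xa; rewrite ?ltxx // => _;
    case: (ltgtP y (a q)) => ya; rewrite ?ltxx // => _.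
  + exact: ltW (lt_trans xa ya).
  + by rewrite ya ltW.
  + by rewrite xa ltW.
  + by rewrite xa ya.
Qed.

Lemma exists_tail_weights n : (0 < n)%N -> exists p, tail_weights mu n p.
Proof.
move=> n0; have [P [[mP P0 Pq0 Pq1] Pmono Pint Pord]] := exists_split_weight.
exists (fun k => P (offer_tail R n k)); split => //.
- by move=> k x; apply: Pmono; exact: offer_tail_antitone.
- by move=> x; rewrite /offer_tail n0 divff ?pnatr_eq0.
- by move=> x; rewrite /offer_tail ltnn.
- by move=> k; rewrite Pint // offer_tail_ge0 offer_tail_le1.
- by move=> k x y; exact: Pord.
Qed.

End Quantiles.

(** * Comparison with the optimum and the competitive ratio *)

Section Ratio.
Variable R : realType.
Implicit Types mu : probability R R.

Lemma greedy_cost_le4 mu n : in_family mu -> exists W : nat -> nat -> R,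
  (iidE mu (fun t : n.-tuple R => (greedy_cost W n 0 t)%:E) <=
   4%:E * OPTn mu n)%E.
Proof.
(* Tail weights exist only for a positive horizon; at horizon 0 both sides vanish. *)
move=> Hmu; case: n => [|n].
  by exists (fun _ _ => 0); rewrite /= /greedy_cost /OPTn /= !big_ord0 mule0.
have [p Hp] := exists_tail_weights Hmu.1 (ltn0Sn n).
exists (cost_to_go mu n.+1 p).
have := greedy_cost_le Hmu Hp 0 (leqnn _) (lexx 0).
under eq_fun do rewrite add0r.
move=> /le_trans; apply; rewrite add0r.
have := OPTn_ge Hmu Hp; rewrite -(@lee_pmul2l R 4%:E) ?lte_fin // => /(le_trans _); apply.
rewrite -EFinM lee_fin mulr_sumr; apply: ler_sum => k _.
rewrite mulrCA ler_wpM2l ?(offer_mean_ge0 Hmu Hp) //.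
apply: le_trans (expected_length_le R _) _; first by rewrite /= ltn_ord.
by rewrite /offer_tail ltn_ord.
Qed.

Lemma exists_greedy_alg_le4 : exists V : probability R R -> nat -> nat -> nat -> R,
  forall mu n, in_family mu -> (ALGn (greedy_alg V) mu n <= 4%:E * OPTn mu n)%E.
Proof.
have /choice[V hV] : forall z : probability R R * nat, exists W : nat -> nat -> R,
    in_family z.1 -> (iidE z.1 (fun t : z.2.-tuple R => (greedy_cost W z.2 0 t)%:E)
      <= 4%:E * OPTn z.1 z.2)%E.
  move=> [mu n] /=; have [Hmu|nHmu] := pselect (in_family mu).
    by have [W] := greedy_cost_le4 n Hmu; exists W.
  by exists (fun _ _ => 0) => /nHmu.
exists (fun mu n => V (mu, n)) => mu n /(hV (mu, n)); rewrite /ALGn /=.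
congr (iidE _ _ <= _)%E; apply/funext => t.
rewrite sumEFin; congr (_%:E); apply: eq_bigr => i _.
by rewrite (tnth_nth 0).
Qed.

Lemma ratio_n_le (A : alg_type R) n (b : R) : 0 <= b ->
  (forall mu, in_family mu -> (ALGn A mu n <= b%:E * OPTn mu n)%E) ->
  (ratio_n A n <= b%:E)%E.
Proof.
move=> b0 h; apply: ge_ereal_sup => _ [mu [Hmu opt0] <-].
have := h mu Hmu; move: opt0; case: (OPTn mu n) => [r| |] //= r0 Ar.
  by rewrite lee_pdivrMr.
(* If the optimum is infinite, [fine] sends it to 0, so the ratio is 0. *)
by rewrite invr0 mule0 lee_fin.
Qed.

Lemma limn_esup_le (u : (\bar R)^nat) l : (forall n, u n <= l)%E -> (limn_esup u <= l)%E.
Proof.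
move=> ul; rewrite limn_esup_lim; apply: lime_le; first exact: is_cvg_esups.
by apply: nearW => m; apply: ge_ereal_sup => _ [k _ <-].
Qed.

End Ratio.

Local Open Scope ring_scope.
Local Open Scope ereal_scope.

Theorem mainTheorem11 (R : realType) :
  exists A : alg_type R,
    online_algorithm A /\
    limn_esup (fun n => ratio_n A n) <= ((4179%:R / 1000%:R)%R)%:E.
Proof.
have [V hV] := exists_greedy_alg_le4 R.
exists (greedy_alg V); split; first exact: greedy_alg_online.
apply: limn_esup_le => n; apply: (@le_trans _ _ 4%:E).
  by apply: ratio_n_le => // mu; exact: hV.
by rewrite lee_fin ler_pdivlMr ?ltr0n // -natrM ler_nat.
Qed.
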